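(* Let $K$ be a field of characteristic zero, let $k\geq 1$ be an integer, and let $R$ be a $K$-algebra which is Lie nilpotent of index $k$. Let $G\subseteq \mathrm{Aut}_K(R)$ be an $n$-element subgroup of the group of $K$-automorphisms of $R$. Then $R$ is right integral over $\mathrm{Fix}(G)$ of degree $n^k$. In other words, for any $r\in R$ we have $$c_0+rc_1+\cdots+r^{n^k-1}c_{n^k-1}+r^{n^k}=0$$ for some $c_i\in \mathrm{Fix}(G)$, $0\leq i\leq n^k-1$.
   Context: Algebras are unitary, associative and not necessarily commutative; $K$-automorphisms are $K$-algebra automorphisms (preserving the identity). With $[x,y]=xy-yx$, a ring $R$ is called Lie nilpotent of index $k$ if the left normed commutator product $[[\ldots[[x_1,x_2],x_3],\ldots,x_k],x_{k+1}]=0$ is a polynomial identity on $R$, i.e. holds for all $x_1,\ldots,x_{k+1}\in R$ (so index $1$ means commutative). For a subgroup $G\subseteq\mathrm{Aut}_K(R)$, $\mathrm{Fix}(G)=\{r\in R\mid \sigma(r)=r\text{ for all }\sigma\in G\}$. *)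

(* Defs.v *)
From mathcomp Require Import all_boot all_order all_algebra.
From mathcomp Require Import boolp classical_sets cardinality.

Set Implicit Arguments.
Unset Strict Implicit.
Unset Printing Implicit Defensive.

Import GRing.Theory.
Local Open Scope ring_scope.
Local Open Scope classical_set_scope.

Definition lie_comm (R : pzRingType) (x y : R) : R := x * y - y * x.

(* [foldl lie_comm x s] with [s = [:: y_1; ...; y_k]] is the left normed
   product [[...[[x, y_1], y_2], ...], y_k] of k + 1 arbitrary elements. *)
Definition lie_nilpotent (R : pzRingType) (k : nat) : Prop :=
  forall (x : R) (s : k.-tuple R), foldl (@lie_comm R) x s = 0.

Definition algebra_automorphism (K : fieldType) (R : algType K) (f : R -> R)
    : Prop :=
  [/\ linear f, GRing.monoid_morphism f & bijective f].

(* Automorphisms are identified with their underlying functions, so the group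
   law of Aut_K(R) is composition of functions. *)
Definition automorphism_subgroup (K : fieldType) (R : algType K)
    (G : set (R -> R)) : Prop :=
  [/\ forall f, G f -> algebra_automorphism f,
      G idfun,
      forall f g, G f -> G g -> G (f \o g)
    & forall f g, G f -> cancel f g -> cancel g f -> G g].

Definition Fix (R : Type) (G : set (R -> R)) : set R :=
  [set r | forall f, G f -> f r = r].

(* The coefficients stand to the right of the powers of [r], and the equation
   is monic of degree exactly [d]. *)
Definition right_integral (R : pzRingType) (S : set R) (d : nat) : Prop :=
  forall r : R, exists c : 'I_d -> R,
    (forall i, S (c i)) /\ \sum_(i < d) r ^+ i * c i + r ^+ d = 0.

(* Main.v *)
Require Import Defs.
From HB Require Import structures.
From mathcomp Require Import all_boot all_order all_algebra all_fingroup.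
From mathcomp Require Import boolp classical_sets cardinality.

Set Implicit Arguments.
Unset Strict Implicit.
Unset Printing Implicit Defensive.

Import GRing.Theory.
Local Open Scope ring_scope.
Local Open Scope classical_set_scope.

(** For [a = X - r] in [S = R[X]], a polynomial with right coefficients vanishes
    at [r] when it lies in [a S], so it suffices to find [a q] fixed by [G] whose
    leading coefficient, in degree [n ^ k], is a positive integer. Put
    [b_0 g = g a] and let [b_{i+1} g] be the sum of the words
    [b_i g_1 * ... * b_i g_n] over all enumerations of [G] with [g_1 = g]. The group
    permutes the [b_i g], and [b_i g] lies in [a S] for [g = 1].

    Let [L_0 = S] and let [L_{i+1}] be the additive span of the commutators [L_i, S]. If the
    [b_i g] are congruent modulo [L_i], then every word in them is congruent to its
    cyclic rotations modulo [L_{i+1}]; averaging over rotations, the [b_{i+1} g] are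
    congruent modulo [L_{i+1}]. As [L_k = 0], the [b_k g] coincide, hence are fixed
    by [G]. *)

(** * Additive spans *)

Inductive add_span (V : zmodType) (P : V -> Prop) : V -> Prop :=
| add_span0 : add_span P 0
| add_span_cons x y : P x -> add_span P y -> add_span P (x + y).

Section AddSpan.
Context {U V : zmodType}.
Implicit Types (P : U -> Prop) (Q : V -> Prop).

Lemma mem_add_span Q x : Q x -> add_span Q x.
Proof. by move=> Qx; rewrite -[x]addr0; apply: add_span_cons => //; apply: add_span0. Qed.

Lemma add_spanD Q x y : add_span Q x -> add_span Q y -> add_span Q (x + y).
Proof.
by move=> Qx Qy; elim: Qx => [|a b Qa _ IH]; rewrite ?add0r -?addrA //; apply: add_span_cons.
Qed.

Lemma add_span_sum Q (I : Type) (r : seq I) (p : pred I) (F : I -> V) :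
  (forall i, p i -> add_span Q (F i)) -> add_span Q (\sum_(i <- r | p i) F i).
Proof. by move=> QF; apply: big_ind => //; [apply: add_span0 | apply: add_spanD]. Qed.

Lemma add_span_morph P Q (f : U -> V) (fD : {morph f : x y / x + y}) x :
  (forall a, P a -> add_span Q (f a)) -> add_span P x -> add_span Q (f x).
Proof.
move=> PQ; elim=> [|a b Pa _ IH]; last by rewrite fD; apply: add_spanD => //; apply: PQ.
suff -> : f 0 = 0 by apply: add_span0.
by apply: (addrI (f 0)); rewrite -fD !addr0.
Qed.

End AddSpan.

(** * Commutator identities and the lower central series *)

Section LieComm.
Context {S : pzRingType}.
Implicit Types x y z : S.

Lemma lie_commDl z : {morph (@lie_comm S)^~ z : x y / x + y}.
Proof. by move=> x y; rewrite /lie_comm mulrDl mulrDr opprD addrACA. Qed.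

Lemma lie_commDr x : {morph @lie_comm S x : y z / y + z}.
Proof. by move=> y z; rewrite /lie_comm mulrDl mulrDr opprD addrACA. Qed.

Lemma lie_comm0l x : lie_comm 0 x = 0.
Proof. by rewrite /lie_comm mul0r mulr0 subrr. Qed.

Lemma lie_comm0r x : lie_comm x 0 = 0.
Proof. by rewrite /lie_comm mul0r mulr0 subrr. Qed.

Lemma lie_commNr x y : lie_comm x (- y) = - lie_comm x y.
Proof. by rewrite /lie_comm mulrN mulNr opprB opprK addrC. Qed.

Lemma lie_commC x y : lie_comm x y = lie_comm y (- x).
Proof. by rewrite lie_commNr /lie_comm opprB. Qed.

Lemma lie_commMr x y z : lie_comm x (y * z) = lie_comm x y * z + y * lie_comm x z.
Proof. by rewrite /lie_comm mulrBl mulrBr !mulrA addrA subrK. Qed.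

(** The brackets in play are additive groups, not ideals; here a commutator with a product splits
    without leaving any outer factor. *)
Lemma lie_comm_cyc x y z : lie_comm (x * y) z = lie_comm x (y * z) + lie_comm y (z * x).
Proof. by rewrite /lie_comm !mulrA addrA subrK. Qed.

Lemma lie_comm_jacobi x y z :
  lie_comm x (lie_comm y z) = lie_comm (lie_comm x y) z + lie_comm y (lie_comm x z).
Proof.
rewrite {2}/lie_comm lie_commDr lie_commNr !lie_commMr opprD.
by rewrite [- (lie_comm x z * y) + _]addrC addrACA.
Qed.

Lemma foldl_lie_comm0 (t : seq S) : foldl (@lie_comm S) 0 t = 0.
Proof. by elim: t => //= y t IH; rewrite lie_comm0l. Qed.

Lemma foldl_lie_commD (t : seq S) :
  {morph (foldl (@lie_comm S))^~ t : x y / x + y}.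
Proof. by elim: t => //= z t IH x y; rewrite lie_commDl IH. Qed.

Definition bracket (M : S -> Prop) : S -> Prop :=
  add_span (fun z => exists m x, M m /\ z = lie_comm m x).

Definition lower_central (i : nat) : S -> Prop := iter i bracket (fun _ => True).

Definition lie_ideal (N : S -> Prop) : Prop := forall x y, N x -> N (lie_comm x y).

Lemma bracket_comm (M : S -> Prop) m x : M m -> bracket M (lie_comm m x).
Proof. by move=> Mm; apply: mem_add_span; exists m, x. Qed.

(** By Jacobi, bracketing [[m, x]] with y gives one term with [[y, m]], still in M, and one term
    with m itself. *)
Lemma lie_ideal_bracket (M : S -> Prop) : lie_ideal M -> lie_ideal (bracket M).
Proof.
move=> idM z y; rewrite lie_commC.
apply: (add_span_morph (f := lie_comm y \o -%R)) => [a b|a [m [x [Mm ->]]]] /=.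
  by rewrite opprD lie_commDr.
rewrite -lie_commNr lie_comm_jacobi.
apply: add_spanD; apply: bracket_comm => //; rewrite lie_commC; exact: idM.
Qed.

Lemma lie_ideal_lower_central i : lie_ideal (lower_central i).
Proof. by elim: i => [|i IH] //; apply: lie_ideal_bracket. Qed.

(** A generator [[m, w]] unwinds to m with w put in front of the list; the descent ends at
    [lower_central 0], where the claim is Lie nilpotency itself. *)
Lemma foldl_lower_central k i x :
  lie_nilpotent S k -> (i <= k)%N -> lower_central i x ->
  forall t : seq S, size t = (k - i)%N -> foldl (@lie_comm S) x t = 0.
Proof.
move=> nilS; elim: i x => [|i IH] x ik.
  move=> _ t; rewrite subn0 => sz.
  by have := nilS x (tcast sz (in_tuple t)); rewrite val_tcast.
move=> Lx t sz; elim: Lx => [|z y [m [w [Lm ->]]] _ IHy]; first exact: foldl_lie_comm0.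
rewrite foldl_lie_commD IHy addr0.
by apply: (IH m (ltnW ik) Lm (w :: t)); rewrite /= sz subnSK.
Qed.

Lemma lower_central_eq0 k x : lie_nilpotent S k -> lower_central k x -> x = 0.
Proof.
move=> nilS Lx; apply: (foldl_lower_central nilS _ Lx (t := [::])) => //=.
by rewrite subnn.
Qed.

End LieComm.

(** * Rotating words modulo a bracket *)

(** The inverse u is asked to be central so that [u * [d, y] = [d, u * y]], which lets integers be
    cancelled inside a bracket. *)
Definition nat_divisible (S : pzRingType) : Prop :=
  forall m : nat, exists u : S, (forall x, u * x = x * u) /\ u * m.+1%:R = 1.

Section Rotation.
Context {S : pzRingType} (k : nat).
Hypothesis nilS : lie_nilpotent S k.
Hypothesis divS : nat_divisible S.
Context (M : S -> Prop).
Hypothesis idM : lie_ideal M.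
Let N := bracket M.
Implicit Types x y z s : S.

(** [add_span] only generates a monoid; here the generators are closed under negation, since the
    sign moves into the second entry. *)
Lemma bracketN x : bracket M x -> bracket M (- x).
Proof.
apply: add_span_morph => [a b|a [m [y [Mm ->]]]]; first exact: opprD.
by rewrite -lie_commNr; apply: bracket_comm.
Qed.

Lemma bracketB x y : bracket M x -> bracket M y -> bracket M (x - y).
Proof. by move=> Nx Ny; apply: add_spanD => //; apply: bracketN. Qed.

Lemma bracket_div m x : bracket M (x *+ m.+1) -> bracket M x.
Proof.
have [u [uC um]] := divS m.
move=> Nx; suff -> : x = u * (x *+ m.+1).
  move: Nx; apply: (add_span_morph (f :=  *%R u)) => [a b|a [d [y [Md ->]]]].
    exact: mulrDr.
  suff -> : u * lie_comm d y = lie_comm d (u * y) by apply: bracket_comm.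
  by rewrite lie_commMr /lie_comm (uC d) subrr mul0r add0r.
by rewrite -mulr_natl mulrA um mul1r.
Qed.

(** The preimage of the centre of the Lie ring S modulo N. It contains M and 1, and is closed under
    sums, products and commutators with any element. *)
Definition bracket_transporter x : Prop := forall y, N (lie_comm x y).
Let A := bracket_transporter.

Lemma transporter_sub x : M x -> A x.
Proof. by move=> Mx y; apply: bracket_comm. Qed.

Lemma transporter1 : A 1.
Proof. by move=> y; rewrite /lie_comm mul1r mulr1 subrr; apply: add_span0. Qed.

Lemma transporterD x y : A x -> A y -> A (x + y).
Proof. by move=> Ax Ay z; rewrite lie_commDl; apply: add_spanD; [apply: Ax | apply: Ay]. Qed.

Lemma transporterM x y : A x -> A y -> A (x * y).
Proof. by move=> Ax Ay z; rewrite lie_comm_cyc; apply: add_spanD; [apply: Ax | apply: Ay]. Qed.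

Lemma transporter_comm s x : A x -> A (lie_comm s x).
Proof.
move=> Ax y; rewrite -[lie_comm (lie_comm s x) y](addrK (lie_comm x (lie_comm s y))).
rewrite -lie_comm_jacobi; apply: bracketB; last exact: Ax.
rewrite lie_commC; apply: lie_ideal_bracket => //; exact: Ax.
Qed.

Lemma comm_exp s x m :
  lie_comm (s ^+ m) x = \sum_(j < m) s ^+ j * lie_comm s x * s ^+ (m.-1 - j).
Proof.
elim: m => [|m IH]; first by rewrite big_ord0 /lie_comm expr0 mulr1 mul1r subrr.
rewrite big_ord_recr /= subnn mulr1 exprSr.
have -> : lie_comm (s ^+ m * s) x = lie_comm (s ^+ m) x * s + s ^+ m * lie_comm s x.
  by rewrite /lie_comm mulrBl mulrBr !mulrA [RHS]addrC subrKA.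
rewrite IH mulr_suml; congr (_ + _); apply: eq_bigr => -[j jm] _ /=.
by rewrite -[LHS]mulrA -exprSr; congr (_ * s ^+ _); case: m jm {IH} => //= m jm; rewrite subSn.
Qed.

(* Modulo [N], the elements [s ^+ a * v * s ^+ b] with [v = [s, x]] and [a + b = m]
   agree, by induction on the nilpotency index of [ad s] at [x]; their sum is
   [s ^+ m.+1, x], which is in [N], and [m.+1] can be cancelled. *)
Lemma transporter_ad s x i j : A x -> N (s ^+ j * lie_comm s x * s ^+ i).
Proof.
have [r] : exists r, foldl (@lie_comm S) x (nseq r s) = 0.
  by exists k; apply: (nilS x (nseq_tuple k s)).
elim: r x i j => [|r IH] x i j.
  move=> /= -> _; rewrite lie_comm0r mulr0 mul0r; exact: add_span0.
move=> /= nil_x Ax; set v := lie_comm s x.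
have Nv a b : N (s ^+ a * lie_comm s v * s ^+ b).
  apply: IH; last exact: transporter_comm.
  (* [foldl] brackets with s on the right, while v has s on the left; additivity carries the
     vanishing across the sign. *)
  rewrite (_ : v = - lie_comm x s); last by rewrite /v /lie_comm opprB.
  have := foldl_lie_commD (nseq r s) (lie_comm x s) (- lie_comm x s).
  by rewrite subrr foldl_lie_comm0 nil_x add0r.
have shift a b : N (s ^+ a * v * s ^+ b - v * s ^+ (a + b)).
  elim: a b => [|a IHa] b; first by rewrite mul1r subrr; apply: add_span0.
  rewrite -[X in N X](subrKA (s ^+ a * v * s ^+ b.+1)); apply: add_spanD; last first.
    by rewrite addSnnS; apply: IHa.
  have := Nv a b; rewrite /lie_comm mulrBr mulrBl !mulrA.
  by rewrite exprSr [s ^+ b.+1]exprS !mulrA.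
have Nvm m : N (v * s ^+ m).
  apply: (@bracket_div m).
  have -> : v * s ^+ m *+ m.+1 = lie_comm (s ^+ m.+1) x
      - \sum_(a < m.+1) (s ^+ a * v * s ^+ (m - a) - v * s ^+ m).
    by rewrite comm_exp /= sumrB sumr_const card_ord subKr.
  apply: bracketB; first by rewrite lie_commC; apply: Ax.
  apply: add_span_sum => -[a am] _ /=.
  by have := shift a (m - a)%N; rewrite subnKC.
by rewrite -[_ * s ^+ i](subrK (v * s ^+ (j + i))); apply: add_spanD; [apply: shift | apply: Nvm].
Qed.

(** This compares the word s w with its rotation w s. Each letter is s plus an element of M, and
    moving s to the right past u in A costs [[s, u]], again in A. What remains is [[s, u] * s ^+ j],
    covered by [transporter_ad]. *)
Lemma comm_prod_congruent s (w : seq S) :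
  (forall b, b \in w -> M (b - s)) -> N (lie_comm s (\prod_(b <- w) b)).
Proof.
pose T := add_span (fun z => exists u j, A u /\ z = u * s ^+ j).
have TA u j : A u -> T (u * s ^+ j) by move=> Au; apply: mem_add_span; exists u, j.
move=> Mw; have : T (\prod_(b <- w) b).
  elim: w Mw => [|b w IH] Mw.
    by rewrite big_nil -[1]mulr1 -(expr0 s); apply: TA; apply: transporter1.
  rewrite big_cons; have /IH : forall b, b \in w -> M (b - s).
    by move=> c cw; apply: Mw; rewrite inE cw orbT.
  apply: (add_span_morph (f :=  *%R b)) => [x y|_ [u [j [Au ->]]]]; first exact: mulrDr.
  (* The product is put in the normal form [\sum_j u_j * s ^+ j] with [u_j] in [A]. *)
  have -> : b * (u * s ^+ j) = u * s ^+ j.+1 + (lie_comm s u + (b - s) * u) * s ^+ j.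
    rewrite /lie_comm mulrBl [_ + (_ - s * u)]addrC addrA subrK mulrBl.
    by rewrite exprS !mulrA addrC subrK.
  apply: add_spanD; apply: TA => //; apply: transporterD; first exact: transporter_comm.
  by apply: transporterM => //; apply: transporter_sub; apply: Mw; rewrite inE eqxx.
apply: add_span_morph => [x y|_ [u [j [Au ->]]]]; first exact: lie_commDr.
rewrite lie_commMr (_ : lie_comm s (s ^+ j) = 0) ?mulr0 ?addr0.
  by have := transporter_ad s j 0 Au; rewrite mul1r.
by rewrite /lie_comm -exprS -exprSr subrr.
Qed.

End Rotation.

(** * Sums of words with a prescribed first letter *)

Definition head_sum (S : pzRingType) m (b : 'I_m.+1 -> S) (j : 'I_m.+1) : S :=
  \sum_(s : 'S_m.+1 | s ord0 == j) \prod_(i < m.+1) b (s i).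

(** Let [W x j] sum the words with j in position x. Rotation makes it independent of x modulo the
    bracket, and summing over x gives all words, whatever j is. So [m.+1] times each head sum is
    congruent to one total, and [m.+1] cancels. *)
Lemma head_sum_congruent (S : pzRingType) k (nilS : lie_nilpotent S k)
    (divS : nat_divisible S) (M : S -> Prop) (idM : lie_ideal M)
    m (b : 'I_m.+1 -> S) :
  (forall i j, M (b i - b j)) ->
  forall i j, bracket M (head_sum b i - head_sum b j).
Proof.
move=> Mb; pose word (s : 'S_m.+1) := \prod_(i < m.+1) b (s i).
pose rot : 'S_m.+1 := perm (@ordS_inj m.+1).
have word_rot s : bracket M (word s - word (rot * s)%g).
  rewrite /word big_ord_recl [X in _ - X]big_ord_recr /=.
  have -> : \prod_(i < m) b ((rot * s)%g (widen_ord (leqnSn m) i)) =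
            \prod_(x <- [seq b (s (lift ord0 i)) | i <- index_enum 'I_m]) x.
    rewrite big_map; apply: eq_bigr => i _; rewrite permM permE.
    by congr (b (s _)); apply: val_inj; rewrite /= modn_small ?ltnS.
  have -> : (rot * s)%g ord_max = s ord0.
    by rewrite permM permE; congr (s _); apply: val_inj; rewrite /= modnn.
  rewrite -(big_map (fun i => b (s (lift ord0 i))) xpredT id).
  by apply: (comm_prod_congruent nilS divS idM) => _ /mapP[i _ ->].
pose W x j := \sum_(s : 'S_m.+1 | s x == j) word s.
have W_rot x j : bracket M (W (ordS x) j - W x j).
  (* Replacing s by [rot * s] turns the condition at x into the condition at [ordS x], so both sums
     run over the same permutations. *)
  rewrite /W [X in _ - X](reindex_inj (mulgI rot)) /=.
  under [X in _ - X]eq_bigl => s do rewrite permM permE.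
  by rewrite -sumrB; apply: add_span_sum => s _; apply: word_rot.
have W0 x j : bracket M (W x j - W ord0 j).
  case: x => l; elim: l => [|l IH] lm.
    have -> : Ordinal lm = ord0 by apply: val_inj.
    by rewrite subrr; apply: add_span0.
  rewrite -(subrKA (W (Ordinal (ltnW lm)) j)); apply: add_spanD; last exact: IH.
  have -> : Ordinal lm = ordS (Ordinal (ltnW lm)).
    by apply: val_inj; rewrite /= modn_small.
  exact: W_rot.
have Wtot j : bracket M ((\sum_s word s) - head_sum b j *+ m.+1).
  have -> : head_sum b j *+ m.+1 = \sum_(x < m.+1) W ord0 j by rewrite sumr_const card_ord.
  have -> : \sum_s word s = \sum_x W x j.
    rewrite /W (exchange_big_dep xpredT) //=; apply: eq_bigr => s _.
    rewrite (big_pred1 ((s^-1)%g j)) // => x.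
    by rewrite /= -[j in LHS](permKV s) (inj_eq perm_inj).
  by rewrite -sumrB; apply: add_span_sum => x _; apply: W0.
move=> i j; apply: (bracket_div divS (m := m)); rewrite mulrnBl.
rewrite -(subrKA (\sum_s word s)) addrC -[X in _ + X]opprB.
exact: bracketB.
Qed.

Lemma head_sum_morph (S : pzRingType) (F : {rmorphism S -> S}) m
    (b : 'I_m.+1 -> S) (p : 'S_m.+1) :
  (forall i, F (b i) = b (p i)) -> forall i, F (head_sum b i) = head_sum b (p i).
Proof.
move=> Fb i; rewrite rmorph_sum /head_sum [RHS](reindex_inj (mulIg p)) /=.
apply: eq_big => s; first by rewrite permM (inj_eq (@perm_inj _ p)).
by move=> _; rewrite rmorph_prod; apply: eq_bigr => l _; rewrite Fb permM.
Qed.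

Lemma head_sum_factor (S : pzRingType) m (b : 'I_m.+1 -> S) j :
  exists q, head_sum b j = b j * q.
Proof.
exists (\sum_(s : 'S_m.+1 | s ord0 == j) \prod_(i < m) b (s (lift ord0 i))).
by rewrite mulr_sumr; apply: eq_bigr => s /eqP <-; rewrite big_ord_recl.
Qed.

Lemma head_sum_lower_central (S : pzRingType) k (nilS : lie_nilpotent S k)
    (divS : nat_divisible S) m (b : 'I_m.+1 -> S) i g h :
  lower_central i (iter i (@head_sum S m) b g - iter i (@head_sum S m) b h).
Proof.
elim: i g h => [|i IH] g h //.
exact: (head_sum_congruent nilS divS (@lie_ideal_lower_central S i)).
Qed.

(** * Positive integer leading coefficients *)

Section PolyLead.
Context {R : nzRingType}.
Implicit Types p q : {poly R}.

(** The degree is only bounded, so zero qualifies with [N = 0] and sums just add the N; positivity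
    is tracked separately. *)
Definition nat_lead d N p : Prop := (size p <= d.+1)%N /\ p`_d = N%:R.

Lemma nat_lead1 : nat_lead 0 1 1.
Proof. by rewrite /nat_lead size_poly1 coef1. Qed.

Lemma nat_leadD d N N' p q : nat_lead d N p -> nat_lead d N' q -> nat_lead d (N + N') (p + q).
Proof.
move=> [sp cp] [sq cq]; rewrite /nat_lead coefD cp cq natrD; split=> //.
by rewrite (leq_trans (size_polyD _ _)) // geq_max sp.
Qed.

Lemma nat_leadM d e N N' p q :
  nat_lead d N p -> nat_lead e N' q -> nat_lead (d + e) (N * N') (p * q).
Proof.
move=> [sp cp] [sq cq]; split.
  rewrite (leq_trans (size_polyMleq _ _)) // -subn1 leq_subLR.
  by rewrite (leq_trans (leq_add sp sq)) // addSn addnS.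
have dde : (d < (d + e).+1)%N by rewrite ltnS leq_addr.
rewrite coefM (bigD1 (Ordinal dde)) //= addKn cp cq natrM big1 ?addr0 // => -[i ilt] /=.
rewrite -val_eqE /= neq_ltn => /orP[id | di].
  by rewrite [q`__]nth_default ?mulr0 // (leq_trans sq) // ltn_subRL ltn_add2r.
by rewrite [p`__]nth_default ?mul0r // (leq_trans sp).
Qed.

Lemma nat_lead_prod (I : Type) (r : seq I) d (N : I -> nat) (p : I -> {poly R}) :
  (forall i, nat_lead d (N i) (p i)) ->
  nat_lead (size r * d) (\prod_(i <- r) N i) (\prod_(i <- r) p i).
Proof.
move=> Np; elim: r => [|i r IH]; first by rewrite !big_nil; apply: nat_lead1.
by rewrite !big_cons mulSn; apply: nat_leadM.
Qed.

Lemma nat_lead_head_sum m d (b : 'I_m.+1 -> {poly R}) :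
  (forall i, exists N, (0 < N)%N /\ nat_lead d N (b i)) ->
  forall i, exists N, (0 < N)%N /\ nat_lead (m.+1 * d) N (head_sum b i).
Proof.
move=> /choice[N bN] j.
exists (\sum_(s : 'S_m.+1 | s ord0 == j) \prod_(i < m.+1) N (s i))%N; split.
  (* The transposition shows that some enumeration starts with j, so the sum is positive. *)
  rewrite (bigD1 (tperm ord0 j)) /= ?tpermL // addn_gt0 prodn_gt0 // => i.
  by case: (bN (tperm ord0 j i)).
apply: (big_ind2 (fun N p => nat_lead (m.+1 * d) N p)).
- by rewrite /nat_lead size_poly0 coef0.
- by move=> *; apply: nat_leadD.
- move=> s _; have := @nat_lead_prod _ (index_enum 'I_m.+1) d (N \o s) (b \o s).
  rewrite [index_enum _]unlock -enumT -cardE card_ord /=; apply => i.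
  by case: (bN (s i)).
Qed.

End PolyLead.

(** * Passage to polynomials and right roots *)

(** As X is central, commutators of monomials are commutators of coefficients times a power of X;
    additivity does the rest. *)
Lemma lie_nilpotent_poly (R : nzRingType) k :
  lie_nilpotent R k -> lie_nilpotent {poly R} k.
Proof.
move=> nilR p s.
pose mono l (z : {poly R}) := exists a (t : seq R) j,
  size t = l /\ z = (foldl (@lie_comm R) a t)%:P * 'X^j.
suff: add_span (mono k) (foldl (@lie_comm {poly R}) p s).
  elim=> [//|_ y [a [t [j [sz ->]]]] _ ->].
  have := nilR a (tcast sz (in_tuple t)); rewrite val_tcast /= => ->.
  by rewrite polyC0 mul0r addr0.
case: s => s /= /eqP <-; elim/last_ind: s => [|s q IH].
  rewrite /= -[p]coefK poly_def; apply: add_span_sum => i _; apply: mem_add_span.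
  by exists p`_i, [::], i; rewrite mul_polyC.
rewrite foldl_rcons; apply: (add_span_morph (f := (@lie_comm _)^~ q)) IH => [x y|_ [a [t [j [sz ->]]]]].
  exact: lie_commDl.
rewrite -[q]coefK poly_def /lie_comm mulr_sumr mulr_suml -sumrB.
apply: add_span_sum => i _; apply: mem_add_span; exists a, (rcons t q`_i), (j + i)%N.
rewrite !size_rcons sz foldl_rcons; split=> //.
have polyXnCA c g h : c%:P * 'X^(g + h) = 'X^g * (c%:P * 'X^h) :> {poly R}.
  by rewrite exprD !mulrA (commr_polyXn c%:P).
rewrite -!mul_polyC /lie_comm polyCB !polyCM mulrBl -!mulrA polyXnCA; congr (_ - _ * _).
by rewrite addnC polyXnCA.
Qed.

Lemma nat_divisible_poly (K : fieldType) (R : algType K) :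
  [pchar K] =i pred0 -> nat_divisible {poly R}.
Proof.
move=> K0 m; exists ((m.+1%:R^-1)%:A : R)%:P; split=> [x|].
  apply/polyP => i; rewrite coefCM coefMC.
  by rewrite -scalerAl mul1r -scalerAr mulr1.
rewrite -polyC_natr -polyCM -scalerAl mul1r -scaler_nat scalerA mulVf ?scale1r //.
by rewrite (pcharf0P K).1.
Qed.

(** The coefficients of the product are [q_(i-1) - r * q_i], so the sum telescopes; the bound on
    [size q] kills the last term. *)
Lemma right_root_XsubM (R : nzRingType) (r : R) (q : {poly R}) d :
  (size q < d)%N -> \sum_(i < d) r ^+ i * (('X - r%:P) * q)`_i = 0.
Proof.
case: d => // d; rewrite ltnS => szq.
transitivity (\sum_(i < d.+1) (r ^+ i * (if i == 0 :> nat then 0 else q`_i.-1) - r ^+ i.+1 * q`_i)).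
  by apply: eq_bigr => i _; rewrite mulrBl coefB coefXM coefCM mulrBr exprSr mulrA.
rewrite sumrB big_ord_recl /= mulr0 add0r [X in _ - X]big_ord_recr /=.
by rewrite [q`_d]nth_default // mulr0 addr0 subrr.
Qed.

(** * The group as an indexed family of ring morphisms *)

Lemma automorphism_rmorphism (K : fieldType) (R : algType K) (f : R -> R) :
  algebra_automorphism f -> exists F : {rmorphism R -> R}, F =1 f.
Proof.
move=> [lin_f mon_f _].
have zf : GRing.zmod_morphism f := GRing.zmod_morphism_linear lin_f.
pose A := GRing.isZmodMorphism.Build R R f zf.
pose B := GRing.isMonoidMorphism.Build R R f mon_f.
pose F : {rmorphism R -> R} := HB.pack f A B.
by exists F.
Qed.

(** Indexing by ordinals turns left translation by a group element into a permutation p, as needed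
    by [head_sum_morph]; the identity in G rules out [n = 0]. *)
Lemma group_enumeration (K : fieldType) (R : algType K) (G : set (R -> R)) n :
    automorphism_subgroup G -> (G #= `I_n)%card ->
  exists m (e : 'I_m.+1 -> {rmorphism R -> R}), [/\ n = m.+1,
    exists i0, e i0 =1 idfun,
    forall f, G f -> exists i, e i =1 f &
    forall i, exists p : 'S_m.+1, forall j, e i \o e j =1 e (p j)].
Proof.
move=> [autG G1 GM _] /card_set_bijP[c [c_lt c_inj c_surj]].
case: n c_lt c_surj => [|m] c_lt c_surj; first by have := c_lt _ G1.
have /choice[h hE] : forall i : 'I_m.+1, exists f, G f /\ c f = i.
  by move=> i; have [f] := c_surj i (ltn_ord i); exists f.
have Gh i : G (h i) by case: (hE i).
have /choice[e eh] : forall i : 'I_m.+1, exists F : {rmorphism R -> R}, F =1 h i.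
  by move=> i; apply: automorphism_rmorphism; apply: autG.
have surj f : G f -> exists i, e i =1 f.
  move=> Gf; exists (Ordinal (c_lt f Gf)) => x; rewrite eh; congr (_ x).
  by apply: c_inj; rewrite ?inE //; case: (hE (Ordinal (c_lt f Gf))).
have e_inj i j : e i =1 e j -> i = j.
  move=> eij; apply: ord_inj; rewrite -(hE i).2 -(hE j).2; congr c.
  by apply: funext => x; rewrite -!eh.
exists m, e; split=> //; first exact: surj.
move=> i; have /choice[p pE] : forall j, exists l, e l =1 e i \o e j.
  move=> j; have [l el] := surj _ (GM _ _ (Gh i) (Gh j)).
  by exists l => x; rewrite el /= !eh.
have p_inj : injective p.
  move=> j j' pjj'; apply: e_inj => x.
  have [_ _ /bij_inj fi] := autG _ (Gh i); apply: fi.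
  by have := pE j x; rewrite pjj' pE /= !eh.
by exists (perm p_inj) => j x; rewrite permE pE.
Qed.

(** * The fixed polynomial and its monic equation *)

Theorem mainTheorem1 (K : fieldType) (charK0 : [pchar K] =i pred0)
    (k : nat) (k_ge1 : (1 <= k)%N)
    (R : algType K) (R_nilp : lie_nilpotent R k)
    (n : nat) (G : set (R -> R))
    (G_subgroup : automorphism_subgroup G) (G_card : (G #= `I_n)%card) :
  right_integral (Fix G) (n ^ k)%N.
Proof.
move=> r; have [m [e [-> [i0 ei0] eG eM]]] := group_enumeration G_subgroup G_card.
pose b0 i : {poly R} := 'X - (e i r)%:P.
pose b i := iter i (@head_sum {poly R} m) b0.
have nilS := lie_nilpotent_poly R_nilp.
have divS := nat_divisible_poly R charK0.
have b_const i j : b k i = b k j.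
  apply/subr0_eq/(lower_central_eq0 nilS).
  exact: (head_sum_lower_central nilS divS).
have b_fix i : map_poly (e i) (b k i0) = b k i0.
  (* At every level [e i] sends index j to index [p j]; constancy at level k is used first, to make
     the right side match. *)
  have [p ep] := eM i; rewrite [RHS](b_const i0 (p i0)).
  rewrite /b; elim: k {b_const nilS R_nilp k_ge1} i0 {ei0} => [|l IH] j.
    by rewrite /= /b0 rmorphB /= map_polyX map_polyC /= -ep.
  exact: (head_sum_morph (F := map_poly (e i))).
have [q bq] : exists q, b k i0 = ('X - r%:P) * q.
  rewrite /b; elim: (k) => [|l [q IH]]; first by exists 1; rewrite mulr1 /= /b0 ei0.
  have [q' bq'] := head_sum_factor (b l) i0.
  by exists (q * q'); rewrite mulrA -IH.
have [N [N0 [szb cb]]] : exists N, (0 < N)%N /\ nat_lead (m.+1 ^ k) N (b k i0).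
  rewrite /b; elim: (k) i0 {ei0 b_fix bq} => [|l IH] i.
    exists 1%N; rewrite expn0; split=> //; split; first by rewrite size_XsubC.
    by rewrite /b0 coefB coefX coefC subr0.
  by rewrite expnS; apply: nat_lead_head_sum.
have NK : N%:R != 0 :> K by rewrite (pcharf0P K).1 // -lt0n.
set d := (m.+1 ^ k)%N in szb cb *.
exists (fun i => N%:R^-1 *: (b k i0)`_i); split=> [i f Gf|].
  have [[linf _ _] [j ej]] := (let: And4 a _ _ _ := G_subgroup in a f Gf, eG f Gf).
  have fZ : scalable f := GRing.scalable_linear linf.
  by rewrite fZ -ej -[in LHS]coef_map /= b_fix.
have sum0 : \sum_(i < d.+1) r ^+ i * (b k i0)`_i = 0.
  (* The range is padded to exceed [size q]; the extra terms vanish because [b k i0] has degree at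
     most d. *)
  have := @right_root_XsubM R r q (d.+1 + (size q).+1) (leq_addl _ _).
  rewrite -bq big_split_ord /= [X in _ + X]big1 ?addr0 // => i _.
  by rewrite nth_default ?mulr0 // (leq_trans szb) // leq_addr.
have := congr1 ( *:%R N%:R^-1) sum0; rewrite scaler0 big_ord_recr /= cb scalerDr scaler_sumr.
rewrite scalerAr -scaler_nat scalerA mulVf // scale1r mulr1 => sumE.
by rewrite -[RHS]sumE; congr (_ + _); apply: eq_bigr => i _; rewrite scalerAr.
Qed.
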